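(* In the AI-augmented cascade model with symmetric prior $\ell_0=0$ and $q,\alpha\in(\tfrac12,1)$: if $\alpha\ge q$, then for either value of the AI prediction $c\in\{0,1\}$, $J_i=c$ for all $i\ge1$, regardless of whether $c=\theta$. That is, the cascade forms at the first user, $\tau=1$, and the final cascade direction is $D_\infty=\operatorname{sign}(\lambda(c;\alpha))$. Consequently no user's private impression is revealed through the public history (for every $i$, $J_i$ does not depend on $s_i$).
   Context: AI-augmented cascade model. A binary state $\theta\in\{0,1\}$ has prior $\pi_0=\Pr(\theta=1)$, $\ell_0=\log\frac{\pi_0}{1-\pi_0}$. Users $i=1,2,\dots$ act sequentially. User $i$ has a private signal (impression) $s_i\in\{0,1\}$ with $\Pr(s_i=\theta\mid\theta)=q$; there is one common AI signal $c\in\{0,1\}$ with $\Pr(c=\theta\mid\theta)=\alpha$, seen by every user; given $\theta$, the variables $c,s_1,s_2,\dots$ are mutually independent. User $i$ observes $s_i$, $c$ and the public history $H_i=(J_1,\dots,J_{i-1})$. Write $L_\rho=\log\frac{\rho}{1-\rho}$ and $\lambda(x;\rho)=(2x-1)L_\rho$ for $x\in\{0,1\}$. The public log-odds are $P_i=\ell_0+\lambda(c;\alpha)+\sum_{j<i}\psi_j(J_j)$, where $\psi_j(J_j)=\log\frac{\Pr(J_j\mid\theta=1,P_j)}{\Pr(J_j\mid\theta=0,P_j)}$. User $i$'s posterior log-odds are $\ell_i=P_i+\lambda(s_i;q)$, and her judgment is $J_i=1$ if $\ell_i>0$, $J_i=0$ if $\ell_i<0$, and $J_i=\mathbf 1\{P_i\ge0\}$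 if $\ell_i=0$ (tie-breaking toward the public component). The cascade-formation time is $\tau=\inf\{i\ge1:|P_i|\ge L_q\}$ and the final cascade direction is $D_\infty=\lim_{i\to\infty}\operatorname{sign}(P_i)\in\{-1,+1\}$. *)

(* Defs.v *)
From HB Require Import structures.
From mathcomp Require Import all_boot all_order all_algebra.
From mathcomp Require Import all_classical all_reals all_analysis.
Import Order.TTheory GRing.Theory Num.Theory.
Import numFieldNormedType.Exports.

Set Implicit Arguments.
Unset Strict Implicit.
Unset Printing Implicit Defensive.

Local Open Scope classical_set_scope.
Local Open Scope ring_scope.

(* Equal to 0 (field convention) when [B] is a null event. *)
Definition cprob d (T : measurableType d) (R : realType) (Pr : probability T R)
    (A B : set T) : R :=
  fine (Pr (A `&` B)) / fine (Pr B).

Definition logodds (R : realType) (rho : R) : R := ln (rho / (1 - rho)).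

Definition signed_logodds (R : realType) (x : bool) (rho : R) : R :=
  (2 * x%:R - 1) * logodds rho.

(* Users are numbered from 1, so [imp 0] is unused; index 0 carries the common
   AI signal instead. *)
Definition signal d (T : measurableType d) (R : realType)
    (Pr : probability T R) (ai : {RV Pr >-> bool})
    (imp : nat -> {RV Pr >-> bool}) (i : nat) : {RV Pr >-> bool} :=
  if i is 0 then ai else imp i.

Record cascade_model d (T : measurableType d) (R : realType)
    (Pr : probability T R) := CascadeModel {
  state : {RV Pr >-> bool};
  ai : {RV Pr >-> bool};
  imp : nat -> {RV Pr >-> bool};
  prior : R;
  ai_acc : R;
  imp_acc : R;
  (* keeps the prior log-odds finite: [ln] and [/] are total, and
     [logodds 0 = logodds 1 = 0] *)
  prior_itv : 0 < prior < 1;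
  state_prior : Pr (state @^-1` [set true]) = prior%:E;
  ai_accE : forall t : bool,
    cprob Pr (ai @^-1` [set t]) (state @^-1` [set t]) = ai_acc;
  imp_accE : forall (i : nat) (t : bool), (1 <= i)%N ->
    cprob Pr (imp i @^-1` [set t]) (state @^-1` [set t]) = imp_acc;
  signal_cond_indep : forall (t : bool) (I : seq nat) (y : nat -> bool),
    uniq I ->
    cprob Pr (\bigcap_(i in [set` I]) (signal ai imp i @^-1` [set y i]))
             (state @^-1` [set t]) =
    \prod_(i <- I)
      cprob Pr (signal ai imp i @^-1` [set y i]) (state @^-1` [set t])
}.

(* The judgment of a user whose public log-odds are [p] and impression is [x]. *)
Definition judge (R : realType) (q p : R) (x : bool) : bool :=
  let l := p + signed_logodds x q in
  if 0 < l then true else if l < 0 then false else 0 <= p.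

Section cascade.
Context d (T : measurableType d) (R : realType) (Pr : probability T R).
Variable M : cascade_model Pr.

(* Log-likelihood ratio of the judgment [x], for the judgment variable [J],
   given that the public log-odds variable [X] takes the value [p]. The
   variable [X] will be discrete, so conditioning on it is elementary. *)
Definition judgment_llr (X : T -> R) (J : T -> bool) (x : bool) (p : R) : R :=
  ln (cprob Pr (J @^-1` [set x])
        (state M @^-1` [set true] `&` X @^-1` [set p]) /
      cprob Pr (J @^-1` [set x])
        (state M @^-1` [set false] `&` X @^-1` [set p])).

(* Meaningful for [1 <= i] (the value at 0 is a copy of the value at 1); the
   closed form is [public_logoddsE] below. *)
Fixpoint public_logodds (i : nat) : T -> R :=
  if i is j.+1 then
    if j == 0%N then
      fun w => logodds (prior M) + signed_logodds (ai M w) (ai_acc M)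
    else
      let J w := judge (imp_acc M) (public_logodds j w) (imp M j w) in
      fun w => public_logodds j w
        + judgment_llr (public_logodds j) J (J w) (public_logodds j w)
  else fun w => logodds (prior M) + signed_logodds (ai M w) (ai_acc M).

Definition judgment (i : nat) (w : T) : bool :=
  judge (imp_acc M) (public_logodds i w) (imp M i w).

Definition psi (i : nat) (x : bool) (w : T) : R :=
  judgment_llr (public_logodds i) (judgment i) x (public_logodds i w).

Lemma public_logoddsE (i : nat) (w : T) : (1 <= i)%N ->
  public_logodds i w =
    logodds (prior M) + signed_logodds (ai M w) (ai_acc M)
    + \sum_(1 <= j < i) psi j (judgment j w) w.
Proof.
elim: i => [//|[|i] IH] _; first by rewrite big_geq//= addr0.
by rewrite big_nat_recr//= addrA -IH.
Qed.

(* The history (J_1, ..., J_(i-1)) observed by user [i]. *)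
Definition history (i : nat) (w : T) : seq bool :=
  [seq judgment j w | j <- iota 1 i.-1].

(* Equal to +oo when no cascade forms. *)
Definition formation_time (w : T) : \bar R :=
  ereal_inf [set (i%:R)%:E | i in
    [set i : nat | (1 <= i)%N /\ logodds (imp_acc M) <= `|public_logodds i w|]].

Definition direction (i : nat) (w : T) : R := Num.sg (public_logodds i w).

Definition final_direction (w : T) : R := lim (direction i w @[i --> \oo]).

End cascade.

(* Main.v *)
(** Since [logodds] is increasing and positive above 1/2, an AI signal at least
as accurate as an impression fixes the sign of every user's posterior, the tie
[ai_acc M = imp_acc M] being broken toward the public component. Every judgment
then repeats the AI signal, which the public log-odds already determine; it
thus has likelihood ratio 1 and leaves the public log-odds unchanged, so
inductively they keep their initial value. *)
Require Import Defs.
From HB Require Import structures.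
From mathcomp Require Import all_boot all_order all_algebra.
From mathcomp Require Import all_classical all_reals all_analysis.
From mathcomp Require Import lra.
Import Order.TTheory GRing.Theory Num.Theory.
Import numFieldNormedType.Exports.

Set Implicit Arguments.
Unset Strict Implicit.
Unset Printing Implicit Defensive.

Local Open Scope classical_set_scope.
Local Open Scope ring_scope.

Lemma logodds_gt0 (R : realType) (rho : R) :
  1 / 2 < rho < 1 -> 0 < logodds rho.
Proof.
move=> /andP[rho_gt rho_lt]; rewrite /logodds ln_gt0// ltr_pdivlMr; lra.
Qed.

Lemma ler_logodds (R : realType) (r s : R) :
  0 < r -> r <= s -> s < 1 -> logodds r <= logodds s.
Proof.
move=> r_gt0 rs s_lt1.
have s_gt0 : 0 < s := lt_le_trans r_gt0 rs.
have r_lt1 : r < 1 := le_lt_trans rs s_lt1.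
rewrite /logodds ler_ln ?posrE ?divr_gt0 ?subr_gt0//.
(* Cross-multiplying gives [r * (1 - s) <= s * (1 - r)], where the products [r * s] cancel. *)
by rewrite ler_pdivrMr ?subr_gt0// mulrAC ler_pdivlMr ?subr_gt0//; lra.
Qed.

Lemma signed_logoddsE (R : realType) (x : bool) (rho : R) :
  signed_logodds x rho = if x then logodds rho else - logodds rho.
Proof. by rewrite /signed_logodds; case: x; rewrite /=; lra. Qed.

Lemma normr_signed_logodds (R : realType) (x : bool) (rho : R) :
  `|signed_logodds x rho| = `|logodds rho|.
Proof. by rewrite signed_logoddsE; case: x; rewrite ?normrN. Qed.

Lemma signed_logodds_inj (R : realType) (rho : R) :
  0 < logodds rho -> injective (fun x => signed_logodds x rho).
Proof.
by move=> rho_gt0 [] []//; rewrite !signed_logoddsE => ?; exfalso; lra.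
Qed.

(** An agreeing impression reinforces the sign of the public term, and an opposing one cannot
    outweigh it; at exact cancellation the tie-break reads the sign of the public term alone. *)
Lemma judge_signed_logodds (R : realType) (q a : R) (c x : bool) :
  0 < logodds q -> logodds q <= logodds a ->
  judge q (signed_logodds c a) x = c.
Proof.
rewrite /judge !signed_logoddsE => q_gt0 qa.
by case: c; case: x; case: ltP => // ?; try case: ltP => // ?;
  try (apply/negP => ?); lra.
Qed.

Lemma cprob_self d (T : measurableType d) (R : realType)
    (Pr : probability T R) (A B : set T) :
  B `<=` A -> cprob Pr A B = (fine (Pr B) != 0)%:R.
Proof.
move=> BA; rewrite /cprob (setIidr BA).
by case: eqVneq => [->|nz]; rewrite ?mul0r ?divff.
Qed.

Section dominant_ai.
Context d (T : measurableType d) (R : realType) (Pr : probability T R).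
Variable M : cascade_model Pr.

(* When one of the two conditioning events is null the ratio is [0 / _] or
   [_ / 0], that is 0, and [ln 0 = 0]. *)
Lemma judgment_llr_determined (X : T -> R) (J : T -> bool) (x : bool) (p : R) :
  X @^-1` [set p] `<=` J @^-1` [set x] -> judgment_llr M X J x p = 0.
Proof.
move=> XJ; rewrite /judgment_llr !cprob_self; try by move=> w [_ /XJ].
by do 2 case: (_ != 0); rewrite ?mul0r ?invr0 ?mulr0 ?divr1 ?ln1 ?ln0.
Qed.

Hypothesis symmetric_prior : logodds (prior M) = 0.
Hypothesis imp_logodds_gt0 : 0 < logodds (imp_acc M).
Hypothesis imp_le_ai : logodds (imp_acc M) <= logodds (ai_acc M).

Lemma public_logodds_ai (i : nat) (w : T) :
  public_logodds M i w = signed_logodds (ai M w) (ai_acc M).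
Proof.
have ai_logodds_gt0 := lt_le_trans imp_logodds_gt0 imp_le_ai.
elim: i w => [|i IH] w /=; first by rewrite symmetric_prior add0r.
case: eqP => _; first by rewrite symmetric_prior add0r.
rewrite judgment_llr_determined ?addr0// => v /=.
rewrite !IH !judge_signed_logodds//.
(* Equal public log-odds at [v] and [w] force equal AI signals, hence equal judgments. *)
exact: signed_logodds_inj.
Qed.

(** With [x] free instead of [imp M i w], this yields both the value of each judgment and its
    insensitivity to the impression. *)
Lemma judge_public_logodds (i : nat) (w : T) (x : bool) :
  judge (imp_acc M) (public_logodds M i w) x = ai M w.
Proof. by rewrite public_logodds_ai judge_signed_logodds. Qed.

Lemma history_ai (n : nat) (w : T) : history M n w = nseq n.-1 (ai M w).
Proof.
rewrite /history -[in RHS](size_iota 1 n.-1).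
(* Only the length of the index list matters, so the induction runs over an arbitrary list. *)
elim: (iota _ _) => //= j s ->; congr cons; exact: judge_public_logodds.
Qed.

End dominant_ai.

Theorem theorem5 (d : measure_display) (T : measurableType d) (R : realType)
    (Pr : probability T R) (M : cascade_model Pr)
    (symmetric_prior : logodds (prior M) = 0)
    (imp_acc_itv : 1 / 2 < imp_acc M < 1)
    (ai_acc_itv : 1 / 2 < ai_acc M < 1)
    (ai_ge_imp : imp_acc M <= ai_acc M) :
  [/\ (forall (i : nat) (w : T), (1 <= i)%N -> judgment M i w = ai M w),
      (forall w : T, formation_time M w = 1%:E),
      (forall w : T,
         cvg (direction M i w @[i --> \oo]) /\
         final_direction M w = Num.sg (signed_logodds (ai M w) (ai_acc M))),
      (forall (i : nat) (w : T) (x : bool), (1 <= i)%N ->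
         judge (imp_acc M) (public_logodds M i w) x = judgment M i w) &
      (* given the common AI signal, the public history carries no information
         about any impression *)
      (forall (i n : nat) (x y : bool) (h : seq bool),
         (1 <= i)%N -> (1 <= n)%N ->
         (0 < Pr (ai M @^-1` [set y] `&` history M n @^-1` [set h]))%E ->
         cprob Pr (imp M i @^-1` [set x])
           (ai M @^-1` [set y] `&` history M n @^-1` [set h]) =
         cprob Pr (imp M i @^-1` [set x]) (ai M @^-1` [set y]))].
Proof.
have q_gt0 := logodds_gt0 imp_acc_itv.
have qa : logodds (imp_acc M) <= logodds (ai_acc M).
  by apply: ler_logodds => //; lra.
have judgeE := judge_public_logodds symmetric_prior q_gt0 qa.
have publicE := public_logodds_ai symmetric_prior q_gt0 qa.
have directionE w :
    direction M ^~ w = cst (Num.sg (signed_logodds (ai M w) (ai_acc M))).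
  by apply/funext => i; rewrite /direction publicE.
split.
- by move=> i w _; exact: judgeE.
(* User 1 already meets the threshold. Index 0 would meet it too, so the lower bound rests on the
   restriction to indices from 1. *)
- move=> w; apply/eqP; rewrite eq_le; apply/andP; split.
  + apply: ereal_inf_lbound; exists 1%N => //; split => //.
    by rewrite publicE normr_signed_logodds (le_trans qa)// ler_norm.
  + by apply: le_ereal_inf_tmp => _ [i [i_gt0 _] <-]; rewrite lee_fin ler1n.
- move=> w; rewrite /final_direction directionE.
  by split; [exact: is_cvg_cst | exact: lim_cst].
- by move=> i w x _; rewrite /judgment !judgeE.
- move=> i n x y h _ _ pos.
  (* Positive probability provides an outcome in the event, so [h] is the constant word in [y];
     every outcome with AI signal [y] then has history [h]. *)
  suff -> : ai M @^-1` [set y] `&` history M n @^-1` [set h] =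
      ai M @^-1` [set y] by [].
  have /set0P[w [/= aiw hw]] :
      ai M @^-1` [set y] `&` history M n @^-1` [set h] != set0.
    by apply: contraTneq pos => ->; rewrite measure0 ltxx.
  have historyE := history_ai symmetric_prior q_gt0 qa.
  apply/setIidl => v /= aiv.
  by rewrite -hw !historyE aiv aiw.
Qed.
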